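(* Consider the setting of the following depth-$2l$ reconstruction. The target network is an arbitrary $$g(x)=\Gamma_l^*W_l^*\,\mathrm{ReLU}\big(\cdots\mathrm{ReLU}(\Gamma_1^*W_1^*x+\beta_1^* )\cdots\big)+\beta_l^*,$$ with $x\in\mathbb{R}^d$, $W_i^*\in\mathbb{R}^{d\times d}$, $\|W_i^*\|\le1$, $\Gamma_i^*$ diagonal $d\times d$, and $\beta_i^*\in\mathbb{R}^d$. The reconstructing network is $$f(x)=\Gamma_{2l}W_{2l}\,\mathrm{ReLU}\big(\cdots\mathrm{ReLU}(\Gamma_1W_1x+\beta_1)\cdots\big)+\beta_{2l},$$ with the following dimensions: - for odd $i$: $W_i\in\mathbb{R}^{d^2\times d}$, $\Gamma_i$ diagonal $d^2\times d^2$, $\beta_i\in\mathbb{R}^{d^2}$; - for even $i$: $W_i\in\mathbb{R}^{d\times d^2}$, $\Gamma_i$ diagonal $d\times d$, $\beta_i\in\mathbb{R}^d$. Suppose each frozen weight matrix is random and sparse: $W_i=\widetilde W_i\circ M_i$. Here $\widetilde W_i$ has i.i.d. entries from a continuous bounded distribution, $M_i$ has i.i.d. $\mathrm{Bern}(p)$ entries, and all these matrices are mutually independent. Then for every $a>0$ there is a constant $C>0$ such that, for all sufficiently large $d$, the following holds. If $l\le d^a$ and $C\sqrt{\log d/d}\le p\le1$, then with probability at least $1-1/d$ there exist diagonal $\Gamma_1,\dots,\Gamma_{2l}$ and vectors $\beta_1,\dots,\beta_{2l}$ such that $f(x)=g(x)$ for all $\|x\|_2\le1$.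
   Context: $\mathrm{ReLU}(t)=\max(t,0)$ is applied entrywise. $\circ$ denotes the Hadamard (entrywise) product. $\mathrm{Bern}(p)$ is the distribution on $\{0,1\}$ with $\mathbb{P}(1)=p$. The $\Gamma_i$ (diagonal) and $\beta_i$ are the tunable normalization-layer scale and shift parameters; the $W_i$ are frozen. *)

(* Defs.v *)
From HB Require Import structures.
From mathcomp Require Import all_boot all_order all_algebra.
From mathcomp Require Import all_classical all_reals all_analysis.
Set Implicit Arguments. Unset Strict Implicit. Unset Printing Implicit Defensive.
Import Order.TTheory GRing.Theory Num.Theory.
Local Open Scope classical_set_scope.
Local Open Scope ring_scope.

Definition relu {R : realType} {n : nat} (v : 'cV[R]_n) : 'cV[R]_n :=
  map_mx (fun t => Num.max t 0) v.

Definition sqnorm {R : realType} {n : nat} (v : 'cV[R]_n) : R :=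
  \sum_(i < n) (v i 0) ^+ 2.

Definition opnorm_le1 {R : realType} {n : nat} (W : 'M[R]_n) : Prop :=
  forall v : 'cV[R]_n, sqnorm (W *m v) <= sqnorm v.

Fixpoint net {R : realType} {d : nat} (blk : nat -> 'cV[R]_d -> 'cV[R]_d)
  (n : nat) (x : 'cV[R]_d) : 'cV[R]_d :=
  match n with
  | 0 => x
  | S m => blk m (match m with 0 => x | _ => relu (net blk m x) end)
  end.

Definition target_net {R : realType} {d : nat} (l : nat)
  (Ws : nat -> 'M[R]_d) (gs : nat -> 'rV[R]_d) (bs : nat -> 'cV[R]_d)
  (x : 'cV[R]_d) : 'cV[R]_d :=
  net (fun k y => diag_mx (gs k) *m (Ws k *m y) + bs k) l x.

(* reconstructing network f of depth 2l, grouped in l pairs of layers.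
   Pair k (0-based) consists of paper layers 2k+1 (odd, d -> d^2) and
   2k+2 (even, d^2 -> d):
   y |-> Gamma_{2k+2} W_{2k+2} ReLU(Gamma_{2k+1} W_{2k+1} y + beta_{2k+1})
          + beta_{2k+2},
   with Gamma_{2k+1} = diag (go k), beta_{2k+1} = bo k,
        Gamma_{2k+2} = diag (ge k), beta_{2k+2} = be k. *)
Definition recon_net {R : realType} {d : nat} (l : nat)
  (Wo : nat -> 'M[R]_(d * d, d)) (We : nat -> 'M[R]_(d, d * d))
  (go : nat -> 'rV[R]_(d * d)) (bo : nat -> 'cV[R]_(d * d))
  (ge : nat -> 'rV[R]_d) (be : nat -> 'cV[R]_d)
  (x : 'cV[R]_d) : 'cV[R]_d :=
  net (fun k y =>
         diag_mx (ge k) *m (We k *m relu (diag_mx (go k) *m (Wo k *m y) + bo k))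
         + be k) l x.

(* Mutual independence of a finite family of real random variables:
   product rule for every choice of measurable sets (taking B i = setT for
   unused indices gives the product rule for every subfamily). *)
Definition mutually_independent {R : realType} {dO : measure_display}
  {O : measurableType dO} (P : probability O R) (I : finType)
  (X : I -> O -> R) : Prop :=
  (forall i, measurable_fun setT (X i)) /\
  forall B : I -> set R, (forall i, measurable (B i)) ->
    fine (P (\bigcap_(i : I) (X i @^-1` B i))) =
    \prod_(i : I) fine (P (X i @^-1` B i)).

Definition continuous_bounded_distr {R : realType} (D : probability R R) : Prop :=
  (forall t : R, D [set t] = 0%E) /\
  exists B : R, D [set` `[- B, B]] = 1%E.

(* Main.v *)
(* Two consecutive layers of the large network with a very large inner bias act
   on a bounded set as the affine map y |-> W_e diag(g) W_o y + const, so they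
   reproduce any target layer as soon as g |-> W_e diag(g) W_o is onto, i.e. as
   soon as the d^2 x d^2 matrix A whose r-th row is (column r of W_e) (x)
   (row r of W_o) is invertible.

   Say that r and the position (i, j) are joined when both masks M_e(i, r) and
   M_o(r, j) are 1.  If the masks admit a perfect matching, then det A is not the
   zero polynomial in the unmasked weights (at the indicator of the matching, A is
   a permutation matrix); det A is affine in each weight separately, so releasing
   the weights one at a time, atomlessness gives det A <> 0 almost surely.

   If there is no perfect matching, Hall's theorem gives a set S of positions and a
   set T of rows with |S| + |T| = d^2 + 1 and no edge between them.  Some broken
   diagonal j = i + h contains at least |S| / d points of S; along it the pairs of
   masks are disjoint, so (S, T) is edge-free with probability at most
   (1 - p^2)^(|S| |T| / d) <= d^(- (K + 7) min(|S|, |T|)) when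
   p^2 >= 2 (K + 7) log d / d.  There are at most d^(4 min(|S|, |T|)) such pairs of
   given sizes, whence a failure probability of at most d^(-K-1) for each pair of
   layers, and d^(-1) over all l <= d^a <= d^K of them. *)
Require Import Defs.
From HB Require Import structures.
From mathcomp Require Import all_boot all_order all_algebra.
From mathcomp Require Import all_classical all_reals all_analysis.
From mathcomp Require Import perm measurable_realfun ring zify.
Import Order.TTheory GRing.Theory Num.Theory.
Set Implicit Arguments. Unset Strict Implicit. Unset Printing Implicit Defensive.

(** * Hall's marriage theorem *)

Definition neighbours (T U : finType) (N : {ffun T -> {set U}}) (S : {set T}) : {set U} :=
  \bigcup_(x in S) N x.

Definition hall (T U : finType) (N : {ffun T -> {set U}}) :=
  forall S : {set T}, #|S| <= #|neighbours N S|.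

Definition delete (T U : finType) (N : {ffun T -> {set U}}) (x : T) (y : U) :
  {ffun T -> {set U}} := [ffun z => if z == x then N z :\ y else N z].

Lemma neighbours_sub (T U : finType) (N N' : {ffun T -> {set U}}) (S : {set T}) :
  (forall x, x \in S -> N x \subset N' x) -> neighbours N S \subset neighbours N' S.
Proof.
move=> h; apply/bigcupsP => x xS.
by apply: fintype.subset_trans (h x xS) _; exact: finset.bigcup_sup.
Qed.

(** A set violating Hall's condition after the deletion must contain [x], since all other
    neighbourhoods are unchanged. The [S] obtained is that set without [x], and the strict
    inequality absorbs the lost element. *)
Lemma not_hall_delete (T U : finType) (N : {ffun T -> {set U}}) (x : T) (y : U) :
  hall N -> ~ hall (delete N x y) ->
  exists S : {set T}, x \notin S /\ #|neighbours N S :|: (N x :\ y)| <= #|S|.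
Proof.
move=> hN hD.
have [/existsP[S hS]|/existsPn h] :=
    boolP [exists S : {set T}, #|neighbours (delete N x y) S| < #|S|]; last first.
  by case: hD => S; rewrite leqNgt; exact: h.
have xS : x \in S.
  apply: contraT => xS; move: hS; rewrite ltnNge => /negP; case.
  apply: leq_trans (hN S) _; apply: subset_leq_card; apply: neighbours_sub => z zS.
  by rewrite ffunE; case: eqP => // zx; rewrite -zx zS in xS.
exists (S :\ x); split; first by rewrite !inE eqxx.
move: hS; rewrite (cardsD1 x) xS add1n ltnS => hS; apply: leq_trans hS.
apply: subset_leq_card; rewrite finset.subUset; apply/andP; split.
  apply/bigcupsP => z; rewrite !inE => /andP[zx zS].
  apply: fintype.subset_trans (finset.bigcup_sup z zS).
  by rewrite ffunE (negbTE zx).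
by apply: fintype.subset_trans (finset.bigcup_sup x xS); rewrite ffunE eqxx.
Qed.

(* Rado: two elements of [N x] cannot both be critical, by submodularity of
   the cardinality of a union. *)
Lemma hall_delete (T U : finType) (N : {ffun T -> {set U}}) (x : T) (y1 y2 : U) :
  hall N -> y1 \in N x -> y2 \in N x -> y1 != y2 ->
  hall (delete N x y1) \/ hall (delete N x y2).
Proof.
move=> hN y1N y2N y12.
case: (boolP [forall S : {set T}, #|S| <= #|neighbours (delete N x y1) S|]).
  by move/forallP; left.
move=> n1; case: (boolP [forall S : {set T}, #|S| <= #|neighbours (delete N x y2) S|]).
  by move/forallP; right.
move=> n2; exfalso.
have [S1 [xS1 c1]] := not_hall_delete hN (fun h => negP n1 (introT forallP h)).
have [S2 [xS2 c2]] := not_hall_delete hN (fun h => negP n2 (introT forallP h)).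
set A : {set U} := neighbours N S1 :|: (N x :\ y1) in c1.
set B : {set U} := neighbours N S2 :|: (N x :\ y2) in c2.
(* As [y1 != y2], the union [A :|: B] contains all of [N x], so Hall's condition can be applied with
   [x] added to [S1 :|: S2]; this is the extra one. *)
have hU : #|S1 :|: S2|.+1 <= #|A :|: B|.
  have -> : #|S1 :|: S2|.+1 = #|x |: (S1 :|: S2)|.
    by rewrite cardsU1 !inE negb_or xS1 xS2.
  apply: leq_trans (hN _) _; apply: subset_leq_card; apply/bigcupsP => z.
  rewrite !inE => /or3P[/eqP->|zS|zS].
  - apply/fintype.subsetP => u uN; rewrite !inE uN !andbT.
    by case: (eqVneq u y1) => [->|]; rewrite ?y12 ?orbT.
  - by apply: fintype.subset_trans (finset.bigcup_sup z zS) _; rewrite -finset.setUA finset.subsetUl.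
  - apply: fintype.subset_trans (finset.bigcup_sup z zS) _.
    by apply: fintype.subset_trans (finset.subsetUr _ _); rewrite finset.subsetUl.
have hI : #|S1 :&: S2| <= #|A :&: B|.
  apply: leq_trans (hN _) _; apply: subset_leq_card; apply/bigcupsP => z.
  rewrite !inE => /andP[z1 z2]; rewrite finset.subsetI; apply/andP; split.
    by apply: fintype.subset_trans (finset.bigcup_sup z z1) _; rewrite finset.subsetUl.
  by apply: fintype.subset_trans (finset.bigcup_sup z z2) _; rewrite finset.subsetUl.
have := leq_add hU hI; rewrite addSn !cardsUI ltnNge => /negP; apply.
exact: leq_add.
Qed.

(** Edges are deleted one at a time, keeping Hall's condition, until every [N x] is a singleton.
    Hall's condition for two-element sets then makes the resulting choice injective. *)
Theorem hall_marriage (T U : finType) (N : {ffun T -> {set U}}) :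
  hall N -> exists2 f : T -> U, injective f & forall x, f x \in N x.
Proof.
have [m] := ubnP (\sum_x #|N x|); elim: m N => // m IH N /ltnSE lem hN.
have step x y : y \in N x -> hall (delete N x y) ->
    exists2 f : T -> U, injective f & forall x, f x \in N x.
  move=> yN /IH[|f fi fN].
    apply: leq_trans lem; rewrite (bigD1 x) //= [X in _ < X](bigD1 x) //= -addSn.
    apply: leq_add; first by rewrite ffunE eqxx (cardsD1 y (N x)) yN.
    by apply: leq_sum => z zx; rewrite ffunE (negbTE zx).
  exists f => // z; have := fN z; rewrite ffunE.
  by case: eqP => // ->; rewrite inE => /andP[].
case: (boolP [exists x, 1 < #|N x|]) => [/existsP[x /card_gt1P[y1 [y2 [h1 h2 h12]]]]|].
  by have [] := hall_delete hN h1 h2 h12; exact: step.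
move=> /existsPn le1.
have N1 x : exists y, N x == [set y].
  suff /finset.cards1P[y ->] : #|N x| == 1 by exists y.
  rewrite eqn_leq leqNgt le1 /=.
  by have := hN [set x]; rewrite cards1 /neighbours big_set1.
exists (fun x => xchoose (N1 x)); last first.
  by move=> x; rewrite {2}(eqP (xchooseP (N1 x))) set11.
move=> x1 x2 /eqP e; apply: contraTeq e => x12; apply/negP => /eqP e.
have := hN [set x1; x2]; rewrite cards2 x12 /neighbours.
rewrite finset.bigcup_setU !big_set1 (eqP (xchooseP (N1 x1))) (eqP (xchooseP (N1 x2))).
by rewrite e finset.setUid cards1.
Qed.
(** * Counting and weights of Hall violators *)

Lemma bin_leq_exp (n m : nat) : ('C(n, m) <= n ^ m)%N.
Proof.
elim: m n => [|m IH] [|n] //.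
rewrite -(leq_pmul2l (ltn0Sn m)) -mul_bin_diag expnS mulnCA.
rewrite leq_mul2l /=.
apply: leq_trans (IH n) _; apply: leq_trans (leq_pmull _ (ltn0Sn m)).
by case: m {IH} => // m; rewrite leq_exp2r.
Qed.

(** For [s <= t], symmetry turns ['C(n, t)] into ['C(n, s - 1)] because [n - t = s - 1]; so both
    factors are at most [n ^ s], with the smaller size in the exponent. *)
Lemma bin_pair_leq (n s t : nat) : (s + t = n.+1)%N ->
  ('C(n, s) * 'C(n, t) <= n ^ (2 * minn s t))%N.
Proof.
wlog st : s t / (s <= t)%N => [H|] e.
  by case/orP: (leq_total s t) => h; [|rewrite mulnC minnC]; apply: H => //; rewrite addnC.
rewrite (minn_idPl st) mul2n -addnn expnD leq_mul ?bin_leq_exp //.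
case: s st e => [|s] st e; first by rewrite bin_small // -e.
have -> : 'C(n, t) = 'C(n, s) by rewrite (_ : t = n - s)%N ?bin_sub; lia.
apply: leq_trans (bin_leq_exp _ _) _; rewrite expnS leq_pmull //; lia.
Qed.

(* Among the [d] broken diagonals [j = i + h] one meets [S] in at least the
   average number of points. *)
Lemma heavy_diagonal (d : nat) (S : {set 'I_d.+1 * 'I_d.+1}) :
  exists h : 'I_d.+1, (#|S| <= d.+1 * #|[set i | (i, (i + h)%R) \in S]|)%N.
Proof.
pose A h := [set i : 'I_d.+1 | (i, (i + h)%R) \in S].
have e : #|S| = \sum_h #|A h|.
  under eq_bigr do rewrite -sum1_card; rewrite -sum1_card.
  rewrite (eq_bigr (fun h => \sum_i (if (i, (i + h)%R) \in S then 1 else 0)%N)); last first.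
    by move=> h _; rewrite -big_mkcond; apply: eq_bigl => i; rewrite inE.
  rewrite exchange_big /= big_mkcond /=.
  rewrite (eq_bigr (fun z => if (z.1, z.2) \in S then 1 else 0)%N); last by case.
  rewrite -(pair_bigA _ (fun i j => if (i, j) \in S then 1 else 0)%N) /=.
  apply: eq_bigr => i _; rewrite (reindex_inj (addrI i)) //=.
have [|h hmax] := bigop.eq_bigmax (fun h => #|A h|); first by rewrite card_ord.
exists h; rewrite e -hmax -[X in (_ <= X * _)%N]card_ord -sum_nat_const.
by apply: leq_sum => k _; exact: leq_bigmax.
Qed.

Lemma subset_of_card (T : finType) (A : {set T}) (m : nat) : (m <= #|A|)%N ->
  exists2 B : {set T}, B \subset A & #|B| = m.
Proof.
move=> /card_geqP[s [us <- sA]]; exists [set x in s].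
  by apply/fintype.subsetP => x; rewrite inE => /sA.
by rewrite cardsE; exact/card_uniqP.
Qed.

Local Open Scope classical_set_scope.
Local Open Scope ring_scope.

(** Since [max(s, t) >= d^2 / 2] and [min(s, t) * max(s, t) = s * t <= d * A * t], the exponent
    [A * t] is at least [min(s, t) * d / 2]. The bound then follows from [1 - p^2 <= exp(- p^2)]. *)
Lemma nonedge_weight (R : realType) (d K A s t : nat) (p : R) :
  (0 < d)%N -> 0 <= p -> p <= 1 -> 2 * K%:R * (ln d%:R / d%:R) <= p ^+ 2 ->
  (s <= d * A)%N -> (s + t = (d * d).+1)%N ->
  (1 - p ^+ 2) ^+ (A * t) <= (d%:R^-1 ^+ K) ^+ minn s t.
Proof.
move=> d0 p0 p1 hp sA st.
have nat_ineq : (minn s t * d <= 2 * (A * t))%N.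
  rewrite -(leq_pmul2l d0) mulnCA.
  have h1 : (minn s t * maxn s t = s * t)%N.
    by case: (leqP s t) => h //; rewrite mulnC.
  have h2 : (s * t <= d * A * t)%N by rewrite leq_mul2r sA orbT.
  have h3 : (d * d <= 2 * maxn s t)%N by lia.
  have h4 : (minn s t * (d * d) <= minn s t * (2 * maxn s t))%N.
    by rewrite leq_mul2l h3 orbT.
  have h5 : (minn s t * (2 * maxn s t) = 2 * (s * t))%N by rewrite -h1; lia.
  by rewrite h5 in h4; apply: leq_trans h4 _; rewrite [leqRHS]mulnCA leq_mul2l mulnA.
have dR : 0 < d%:R :> R by rewrite ltr0n.
have p2 : p ^+ 2 <= 1 by rewrite expr_le1.
have e1 : 1 - p ^+ 2 <= expR (- p ^+ 2) by exact: expR_ge1Dx.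
apply: le_trans (_ : expR (- p ^+ 2) ^+ (A * t) <= _).
  by rewrite lerXn2r // ?nnegrE ?expR_ge0 ?subr_ge0.
have -> : (d%:R^-1 : R) = expR (- ln d%:R) by rewrite expRN lnK // posrE.
rewrite -exprM -!expRM_natl ler_expR !mulrN lerN2.
have L0 : 0 <= ln d%:R :> R by rewrite ln_ge0 // ler1n.
apply: le_trans (_ : (A * t)%:R * (2 * K%:R * (ln d%:R / d%:R)) <= _); last first.
  by apply: ler_wpM2l.
have -> : (A * t)%:R * (2 * K%:R * (ln d%:R / d%:R)) =
   (2 * (A * t))%:R / d%:R * (K%:R * ln d%:R) :> R.
  by rewrite [in RHS]natrM; ring.
have -> : (K * minn s t)%:R * ln d%:R = (minn s t)%:R * (K%:R * ln d%:R) :> R.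
  by rewrite natrM; ring.
apply: ler_wpM2r; first exact: mulr_ge0.
by rewrite ler_pdivlMr // -natrM ler_nat.
Qed.

(** The pairs are grouped by the size of the first set. With [m] the smaller of the two sizes, a
    class has at most [d^(4m)] pairs, so it weighs at most [d^(-(K+3)m) <= d^(-(K+3))]; the [d^2]
    nonempty classes together give [d^(-(K+1))]. *)
Lemma hall_weight_sum (R : realType) (d K : nat) (T U : finType) :
  (0 < d)%N -> #|T| = (d * d)%N -> #|U| = (d * d)%N ->
  \sum_(z : {set T} * {set U} | (#|z.1| + #|z.2| == (d * d).+1)%N)
     ((d%:R : R)^-1 ^+ (K + 7)) ^+ minn #|z.1| #|z.2| <= (d%:R)^-1 ^+ K.+1.
Proof.
move=> d0 cT cU; set n := (d * d)%N; set q : R := _^-1.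
have dR : 0 < d%:R :> R by rewrite ltr0n.
have q0 : 0 <= q by rewrite invr_ge0 ltW.
have q1 : q <= 1 by rewrite invf_le1 // ler1n.
rewrite (partition_big (fun z : {set T} * {set U} => inord #|z.1| : 'I_n.+1) xpredT) //=.
have inner (s : 'I_n.+1) :
    \sum_(z : {set T} * {set U} | (#|z.1| + #|z.2| == n.+1)%N && (inord #|z.1| == s))
      (q ^+ (K + 7)) ^+ minn #|z.1| #|z.2| =
    ('C(n, s) * 'C(n, n.+1 - s))%:R * (q ^+ (K + 7)) ^+ minn s (n.+1 - s).
  have cdT k : #|[set A : {set T} | #|A| == k]%SET| = 'C(n, k) by rewrite card_draws cT.
  have cdU k : #|[set A : {set U} | #|A| == k]%SET| = 'C(n, k) by rewrite card_draws cU.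
  rewrite -(cdT s) -(cdU (n.+1 - s)%N) -cardsX -sum1_card natr_sum mulr_suml.
  apply: eq_big => [[A B]|[A B]] /=.
    rewrite !inE /=; apply/andP/andP => [[/eqP h /eqP <-]|[/eqP h1 /eqP h2]].
      have An : (#|A| < n.+1)%N by rewrite ltnS /n -cT max_card.
      by rewrite inordK // eqxx; split=> //; apply/eqP; rewrite -/n in h *; lia.
    split; first by rewrite h1 h2 -/n; apply/eqP; have := ltn_ord s; lia.
    by rewrite h1 inord_val.
  move=> /andP[/eqP h /eqP <-]; rewrite mul1r.
  have An : (#|A| < n.+1)%N by rewrite ltnS /n -cT max_card.
  by rewrite inordK //; congr (_ ^+ minn _ _); lia.
(* Size 0 would force the second set to have [n + 1] elements, so that class is empty; in the others
   [m >= 1]. *)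
rewrite (eq_bigr _ (fun s _ => inner s)) big_ord_recl /= subn0.
rewrite [X in (_ * X)%:R]bin_small // muln0 mul0r add0r.
apply: le_trans (_ : \sum_(s < n) q ^+ (K + 3) <= _).
  apply: ler_sum => s _; rewrite /bump /= add1n.
  set m := minn _ _.
  have m1 : (0 < m)%N by rewrite /m; have := ltn_ord s; lia.
  have hc : ('C(n, s.+1) * 'C(n, n.+1 - s.+1) <= (n ^ (2 * m)))%N.
    by apply: bin_pair_leq; have := ltn_ord s; lia.
  apply: le_trans (_ : (n ^ (2 * m))%:R * (q ^+ (K + 7)) ^+ m <= _).
    by rewrite ler_wpM2r ?ler_nat // !exprn_ge0.
  have -> : (n ^ (2 * m))%:R * (q ^+ (K + 7)) ^+ m = (q ^+ (K + 3)) ^+ m :> R.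
    rewrite natrX exprM -exprMn; congr (_ ^+ m).
    have -> : (K + 7 = 4 + (K + 3))%N by lia.
    rewrite exprD mulrA -[RHS]mul1r; congr (_ * _).
    rewrite /n natrM -expr2 -exprM -exprMn mulfV ?expr1n //; exact: lt0r_neq0.
  case: m m1 {hc} => // m _; rewrite exprS ler_piMr ?exprn_ge0 // exprn_ile1 ?exprn_ge0 //.
  by rewrite exprn_ile1.
rewrite sumr_const card_ord -mulr_natl /n natrM.
have -> : (K + 3 = 2 + K.+1)%N by lia.
by rewrite exprD mulrA -expr2 -exprMn mulfV ?expr1n ?mul1r //; exact: lt0r_neq0.
Qed.

(** * Independent families *)

(** By independence the law of [(Z, X)] is the product of the two laws, so the probability of [N] is
    the integral over [z] of the probabilities of its sections. *)
Lemma independent_sections_null (R : realType) (dO dT dU : measure_display)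
  (O : measurableType dO) (T : measurableType dT) (U : measurableType dU)
  (P : probability O R) (Z : O -> T) (X : O -> U) (N : set (T * U)) :
  measurable_fun setT Z -> measurable_fun setT X ->
  (forall A B, measurable A -> measurable B ->
     P (Z @^-1` A `&` X @^-1` B) = (P (Z @^-1` A) * P (X @^-1` B))%E) ->
  measurable N -> (forall z, P (X @^-1` xsection N z) = 0%E) ->
  P [set w | N (Z w, X w)] = 0%E.
Proof.
move=> mZ mX ind mN N0.
have mZX : measurable_fun setT (fun w => (Z w, X w)) by exact: measurable_fun_pair.
pose Zm : {mfun O >-> T} := HB.pack Z (isMeasurableFun.Build _ _ _ _ _ mZ).
pose Xm : {mfun O >-> U} := HB.pack X (isMeasurableFun.Build _ _ _ _ _ mX).
pose ZX : {mfun O >-> (T * U)%type} :=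
  HB.pack (fun w => (Z w, X w)) (isMeasurableFun.Build _ _ _ _ _ mZX).
rewrite -[LHS]/(distribution P ZX N).
rewrite -(@product_measure_unique _ _ _ _ _ (distribution P Zm)
  (distribution P Xm) (distribution P ZX) ind N mN).
by rewrite /product_measure1; apply: integral0_eq => z _ /=; exact: N0.
Qed.

Lemma fineM_probability (R : realType) (dO : measure_display)
  (O : measurableType dO) (P : probability O R) (A B C : set O) :
  measurable A -> measurable B -> measurable C ->
  fine (P C) = fine (P A) * fine (P B) -> P C = (P A * P B)%E.
Proof.
move=> mA mB mC h.
rewrite -(fineK (fin_num_measure P C mC)) h EFinM !fineK //; exact: fin_num_measure.
Qed.

Section independent_family.
Context (R : realType) (dO : measure_display) (O : measurableType dO)
  (P : probability O R) (I : finType) (X : I -> O -> R).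
Hypothesis indX : mutually_independent P X.

(** A family closed under finite intersections; it generates the sigma-algebra of all the variables
    other than [X j]. *)
Definition cylinders_off (j : I) : set (set O) :=
  [set A | exists B : I -> set R, (forall i, measurable (B i)) /\ B j = setT /\
     A = \bigcap_(i : I) (X i @^-1` B i)].

Lemma measurable_cylinder (B : I -> set R) : (forall i, measurable (B i)) ->
  measurable (\bigcap_(i : I) (X i @^-1` B i)).
Proof.
move=> mB; apply: fin_bigcap_measurable; first exact: finite_finset.
by move=> i _; rewrite -[X in measurable X]setTI; apply: indX.1.
Qed.

Lemma cylinder_indep (j : I) (A : set O) (C : set R) :
  cylinders_off j A -> measurable C ->
  P (A `&` X j @^-1` C) = (P A * P (X j @^-1` C))%E.
Proof.
move=> [B [mB [Bj ->]]] mC.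
have mXC : measurable (X j @^-1` C).
  by rewrite -[X in measurable X]setTI; apply: indX.1.
pose B' i := if i == j then C else B i.
have mB' i : measurable (B' i) by rewrite /B'; case: ifP.
have E : \bigcap_(i : I) (X i @^-1` B i) `&` X j @^-1` C =
         \bigcap_(i : I) (X i @^-1` B' i).
  apply/seteqP; split => w /=.
    by move=> [h hj] i _; rewrite /B'; case: eqP => [->//|_]; exact: h.
  move=> h; split; last by have := h j Logic.I; rewrite /B' eqxx.
  move=> i _; have := h i Logic.I; rewrite /B'; case: eqP => // -> _.
  by rewrite /= Bj.
rewrite E; apply: fineM_probability => //; [exact: measurable_cylinder..|].
rewrite !indX.2 // (bigD1 j) //= [X in _ = X * _](bigD1 j) //= /B' eqxx Bj.
rewrite preimage_setT probability_setT /= mul1r mulrC; congr (_ * _).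
by apply: eq_bigr => i /negbTE ->.
Qed.

Lemma sigma_cylinder_indep (j : I) (A : set O) (C : set R) :
  <<s cylinders_off j >> A -> measurable C ->
  measurable A /\ P (A `&` X j @^-1` C) = (P A * P (X j @^-1` C))%E.
Proof.
move=> sA mC.
have mXC : measurable (X j @^-1` C).
  by rewrite -[X in measurable X]setTI; apply: indX.1.
have sub : <<s cylinders_off j >> `<=` (measurable : set (set O)).
  apply: smallest_sub; first exact: sigma_algebra_measurable.
  by move=> _ [B [mB [_ ->]]]; exact: measurable_cylinder.
pose Q (A : set O) := P (A `&` X j @^-1` C) = (P A * P (X j @^-1` C))%E.
have Qbigcup (F : (set O)^nat) : (forall n, measurable (F n)) ->
    trivIset [set: nat] F -> (forall n, Q (F n)) -> Q (\bigcup_k F k).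
  rewrite /Q => mF tF QF; rewrite setI_bigcupl !measure_bigcup //.
  - have -> : P (X j @^-1` C) = (fine (P (X j @^-1` C)))%:E.
      by rewrite fineK // fin_num_measure.
    rewrite muleC -nneseriesZl //; apply: eq_eseriesr => n _.
    rewrite fineK ?fin_num_measure // muleC; exact: QF.
  - by move=> n _; exact: measurableI.
  - exact: trivIset_setIr.
split; first exact: sub.
apply: (@dynkin_induction _ (g_sigma_algebraType (cylinders_off j))
  (cylinders_off j) Q) => //.
- move=> _ _ [B1 [mB1 [B1j ->]]] [B2 [mB2 [B2j ->]]].
  exists (fun i => B1 i `&` B2 i); split=> [i|]; first exact: measurableI.
  rewrite B1j B2j setTI; split=> //.
  rewrite -bigcapI; apply: eq_bigcapr => i _.
  by rewrite preimage_setI.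
- by rewrite /Q setTI probability_setT mul1e.
- by move=> B GB; exact: cylinder_indep.
- move=> S /sub mS QS; rewrite /Q.
  have -> : ~` S `&` X j @^-1` C = X j @^-1` C `\` (S `&` X j @^-1` C).
    apply/seteqP; split => w /=; first by move=> [nS ?]; split=> // -[].
    by move=> [? h]; split=> // ?; apply: h.
  rewrite measureD //=; last 2 first.
  - exact: measurableI.
  - by rewrite ltey_eq fin_num_measure.
  rewrite setIA [X in X `&` _]setIC -setIA setIid QS probability_setC //.
  rewrite -(fineK (fin_num_measure P _ mS)) -(fineK (fin_num_measure P _ mXC)).
  by rewrite -EFinM -!EFinB -EFinM mulrBl mul1r.
- by move=> F mF tF QF; apply: Qbigcup => // n; exact: (sub _ (mF n)).
Qed.

Lemma measurable_off (i j : I) : i != j ->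
  measurable_fun setT (X i : g_sigma_algebraType (cylinders_off j) -> R).
Proof.
move=> ij _ B mB; rewrite setTI; apply: sub_gen_smallest.
exists (fun k => if k == i then B else setT); split=> [k|]; first by case: ifP.
rewrite eq_sym (negbTE ij); split=> //; apply/seteqP; split=> w /=.
  by move=> Bw k _ /=; case: eqP => // ->.
by move=> /(_ i Logic.I) /=; rewrite eqxx.
Qed.

(** * Almost sure non-vanishing of functions that are affine in each atomless variable *)

Lemma measurable_zero_set d (T : measurableType d) (f : T -> R) :
  measurable_fun setT f -> measurable [set t | f t = 0].
Proof.
move=> mf; rewrite -[X in measurable X]setTI.
exact: (mf measurableT [set 0] (measurable_set1 0)).
Qed.

(** Quantifying over all measurable sources [T] avoids a sigma-algebra on [I -> R], and lets the
    same [F] be used on [O] and on [O] with the smaller sigma-algebra of [cylinders_off j]. *)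
Definition measurable_functional (F : (I -> R) -> R) :=
  forall d (T : measurableType d) (Z : I -> T -> R),
    (forall i, measurable_fun setT (Z i)) ->
    measurable_fun setT (fun t => F (fun i => Z i t)).

Definition upd (x : I -> R) (j : I) (t : R) : I -> R :=
  fun i => if i == j then t else x i.

Definition affine_in (j : I) (F : (I -> R) -> R) :=
  forall x t, F (upd x j t) =
              F (upd x j 0) + t * (F (upd x j 1) - F (upd x j 0)).

Definition freeze (x0 : I -> R) (s : seq I) (x : I -> R) : I -> R :=
  fun i => if i \in s then x0 i else x i.

Lemma measurable_freeze d (T : measurableType d) (Z : I -> T -> R) x0 s i :
  (i \notin s -> measurable_fun setT (Z i)) ->
  measurable_fun setT (fun t => freeze x0 s (fun i => Z i t) i).
Proof.
rewrite /freeze; case: (i \in s) => mZ; first exact: measurable_cst.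
exact: mZ.
Qed.

(* Given everything but [X j], the affine function [t |-> F (upd _ j t)] is not
   identically zero, so it vanishes at one point at most. *)
Lemma unfreeze1_null (F : (I -> R) -> R) (x0 : I -> R) (s : seq I) (j : I) :
  measurable_functional F -> affine_in j F -> j \notin s ->
  (forall c, P (X j @^-1` [set c]) = 0%E) ->
  P [set w | F (freeze x0 s (fun i => X i w)) = 0 /\
             F (freeze x0 (j :: s) (fun i => X i w)) <> 0] = 0%E.
Proof.
move=> mF aF js atomless.
pose T := g_sigma_algebraType (cylinders_off j).
pose A u (w : T) := F (upd (freeze x0 (j :: s) (fun i => X i w)) j u).
pose b w := A 1 w - A 0 w.
have mA u : measurable_fun setT (A u).
  apply: (mF _ T (fun i w => upd (freeze x0 (j :: s) (fun i => X i w)) j u i)) => i.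
  rewrite /upd; case: (eqVneq i j) => [_|ij]; first exact: measurable_cst.
  apply: (@measurable_freeze _ T) => _; exact: measurable_off.
have mb : measurable_fun setT b by exact: measurable_funB.
pose N : set (T * R) := [set z | A 0 z.1 + z.2 * b z.1 = 0] `&`
                       ~` [set z | A 0 z.1 + x0 j * b z.1 = 0].
have mN : measurable N.
  apply: measurableI; last apply: measurableC; apply: measurable_zero_set;
    apply: measurable_funD.
  - by apply: measurableT_comp (mA 0) _; exact: measurable_fst.
  - apply: measurable_funM; first exact: measurable_snd.
    by apply: measurableT_comp mb _; exact: measurable_fst.
  - by apply: measurableT_comp (mA 0) _; exact: measurable_fst.
  - apply: measurable_funM; first exact: measurable_cst.
    by apply: measurableT_comp mb _; exact: measurable_fst.
have E : [set w | F (freeze x0 s (fun i => X i w)) = 0 /\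
             F (freeze x0 (j :: s) (fun i => X i w)) <> 0] =
    [set w | N (w, X j w)].
  have e1 w : freeze x0 s (fun i => X i w) =
      upd (freeze x0 (j :: s) (fun i => X i w)) j (X j w).
    apply/funext => i; rewrite /freeze /upd inE; case: eqP => // ->.
    by rewrite (negbTE js).
  have e2 w : freeze x0 (j :: s) (fun i => X i w) =
      upd (freeze x0 (j :: s) (fun i => X i w)) j (x0 j).
    apply/funext => i; rewrite /freeze /upd inE; case: eqP => // ->.
    by [].
  have f1 w : F (freeze x0 s (fun i => X i w)) = A 0 w + X j w * b w.
    by rewrite e1 aF.
  have f2 w : F (freeze x0 (j :: s) (fun i => X i w)) = A 0 w + x0 j * b w.
    by rewrite [in LHS]e2 aF.
  by apply/seteqP; split=> w /=; rewrite f1 f2.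
rewrite E.
(* The conditioning variable is the identity of [O], whose target carries only the sigma-algebra of
   the variables other than [X j]. *)
apply: (@independent_sections_null _ _ _ _ O T _ P (fun w => w : T) (X j)) => //.
- move=> _ B mB; rewrite setTI.
  exact: (sigma_cylinder_indep mB (@measurableT _ _)).1.
- exact: indX.1.
- by move=> B C mB mC; exact: (sigma_cylinder_indep mB mC).2.
move=> w; apply/eqP; rewrite -measure_le0.
have mS : measurable (xsection N w) by exact: measurable_xsection.
have mX B : measurable B -> measurable (X j @^-1` B).
  by move=> mB; rewrite -[X in measurable X]setTI; apply: indX.1.
rewrite -(atomless (- A 0 w / b w)); apply: le_measure.
- by rewrite inE; exact: mX.
- by rewrite inE; exact: mX.
move=> o; rewrite /= /xsection /= inE => -[/= h0 h1].
(* With zero slope the function would take the same value at [X j o] and at [x0 j], contradicting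
   [h1]; otherwise its only root is [- A 0 w / b w]. *)
have [b0|b0] := eqVneq (b w) 0.
  by case: h1; move: h0; rewrite b0 !mulr0.
by rewrite -(mulfK b0 (X j o)); congr (_ / _); apply/eqP; rewrite -addr_eq0 addrC h0.
Qed.

Lemma measurable_vanishing (F : (I -> R) -> R) (x0 : I -> R) (s : seq I) :
  measurable_functional F ->
  measurable [set w | F (freeze x0 s (fun i => X i w)) = 0].
Proof.
move=> mF; apply: measurable_zero_set.
apply: (mF _ O (fun i w => freeze x0 s (fun i => X i w) i)) => i.
by apply: measurable_freeze => _; exact: indX.1.
Qed.

(** Telescoping: if [F] vanishes with nothing frozen but not with all of [s] frozen, then freezing
    some single variable makes it nonzero, and each such event is null. *)
Lemma unfreeze_null (F : (I -> R) -> R) (x0 : I -> R) (s : seq I) :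
  measurable_functional F -> uniq s -> (forall j, j \in s -> affine_in j F) ->
  (forall j c, j \in s -> P (X j @^-1` [set c]) = 0%E) ->
  P [set w | F (fun i => X i w) = 0 /\
             F (freeze x0 s (fun i => X i w)) <> 0] = 0%E.
Proof.
move=> mF; have mv s' := measurable_vanishing x0 s' mF.
have fr0 w : freeze x0 [::] (fun i => X i w) = (fun i => X i w) by [].
elim: s => [|j s IH] /=.
  move=> _ _ _; rewrite [X in P X](_ : _ = set0) ?measure0 //.
  by apply/seteqP; split=> w //= [].
move=> /andP[js us] aF at0.
have h1 := unfreeze1_null x0 mF (aF j (mem_head _ _)) js
  (fun c => at0 j c (mem_head _ _)).
have h2 : P [set w | F (fun i => X i w) = 0 /\
             F (freeze x0 s (fun i => X i w)) <> 0] = 0%E.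
  by apply: IH => // [i|i c] ii; [apply: aF|apply: at0]; rewrite inE ii orbT.
apply/eqP; rewrite -measure_le0.
pose S0 := [set w | F (freeze x0 [::] (fun i => X i w)) = 0].
pose S1 := [set w | F (freeze x0 s (fun i => X i w)) = 0].
pose S2 := [set w | F (freeze x0 (j :: s) (fun i => X i w)) = 0].
have m0 : measurable S0 by exact: mv.
have m1 : measurable S1 by exact: mv.
have m2 : measurable S2 by exact: mv.
have -> : [set w | F (fun i => X i w) = 0 /\
    F (freeze x0 (j :: s) (fun i => X i w)) <> 0] = S0 `&` ~` S2 by [].
apply: (@le_trans _ _ (P ((S0 `&` ~` S1) `|` (S1 `&` ~` S2)))).
  apply: le_measure; rewrite ?inE.
  - by apply: measurableI => //; exact: measurableC.
  - by apply: measurableU; apply: measurableI => //; exact: measurableC.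
  move=> w [a0 a2]; have [a1|a1] := pselect (S1 w); first by right.
  by left.
have -> : P ((S0 `&` ~` S1) `|` (S1 `&` ~` S2)) = 0%E; last by [].
rewrite measureU0 //; by apply: measurableI => //; exact: measurableC.
Qed.

(** * Probability that disjoint pairs of independent masks are never both 1 *)

Definition ones_without_pairs (q : seq I) (s : seq (I * I)) : set O :=
  [set w | (forall t, t \in q -> X t w = 1) /\
           (forall z, z \in s -> ~ (X z.1 w = 1 /\ X z.2 w = 1))].

Lemma measurable_eq1 t : measurable [set w | X t w = 1].
Proof.
rewrite -[X in measurable X]setTI.
exact: (indX.1 t measurableT [set 1] (measurable_set1 1)).
Qed.

Lemma measurable_ones_without_pairs q s : measurable (ones_without_pairs q s).
Proof.
have -> : ones_without_pairs q s =
    (\bigcap_(t in [set` q]) [set w | X t w = 1]) `&`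
    (\bigcap_(z in [set` s]) ~` ([set w | X z.1 w = 1] `&` [set w | X z.2 w = 1])).
  by apply/seteqP; split=> w /= [h1 h2]; (split=> t /=; [exact: h1|exact: h2]).
apply: measurableI; apply: fin_bigcap_measurable; try exact: finite_seq.
  by move=> t _; exact: measurable_eq1.
by move=> z _; apply: measurableC; apply: measurableI; exact: measurable_eq1.
Qed.

Lemma prob_ones (p : R) (q : seq I) : uniq q ->
  (forall t, t \in q -> P (X t @^-1` [set 1]) = p%:E) ->
  P (ones_without_pairs q [::]) = (p ^+ size q)%:E.
Proof.
move=> uq pq.
pose B t : set R := if t \in q then [set 1] else setT.
have mB t : measurable (B t) by rewrite /B; case: ifP.
have -> : ones_without_pairs q [::] = \bigcap_(t : I) (X t @^-1` B t).
  apply/seteqP; split => w /=.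
    by move=> [h _] t _; rewrite /B /=; case: ifP => // /h.
  by move=> h; split=> // t tq; have := h t Logic.I; rewrite /B /= tq.
rewrite -[LHS]fineK; last by rewrite fin_num_measure //; exact: measurable_cylinder.
rewrite indX.2 //; congr _%:E.
rewrite (bigID (mem q)) /= [X in _ * X]big1 ?mulr1; last first.
  by move=> t /negbTE tq; rewrite /B tq preimage_setT probability_setT.
rewrite -big_uniq //= (eq_big_seq (fun=> p)); last first.
  by move=> t tq; rewrite /B tq pq.
by rewrite big_const_seq count_predT iter_mulr_1.
Qed.

(* The event for [(a, b) :: s] is the one for [s] minus the one where moreover
   [X a = X b = 1]. *)
Lemma prob_ones_without_pairs (p : R) (s : seq (I * I)) (q : seq I) :
  uniq (q ++ unzip1 s ++ unzip2 s) ->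
  (forall t, t \in q ++ unzip1 s ++ unzip2 s -> P (X t @^-1` [set 1]) = p%:E) ->
  P (ones_without_pairs q s) = (p ^+ size q * (1 - p ^+ 2) ^+ size s)%:E.
Proof.
(* The list [q] must vary in the induction, because the subtracted event moves [a] and [b] into
   it. *)
elim: s q => [|[a b] s IH] q /=.
  by rewrite cats0 expr0 mulr1; exact: prob_ones.
set L := q ++ _ => uL pL.
have perm1 : perm_eq L ([:: a, b & q] ++ unzip1 s ++ unzip2 s).
  by apply/seq.permP => x; rewrite /L /= !count_cat /= !count_cat /=; lia.
have perm2 : perm_eq L ([:: a; b] ++ q ++ unzip1 s ++ unzip2 s) by exact: perm1.
have IH1 : P (ones_without_pairs q s) = (p ^+ size q * (1 - p ^+ 2) ^+ size s)%:E.
  apply: IH.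
    by move: uL; rewrite (perm_uniq perm2) cat_uniq => /and3P[].
  by move=> t tq; apply: pL; rewrite (perm_mem perm2) mem_cat tq orbT.
have IH2 : P (ones_without_pairs [:: a, b & q] s) =
    (p ^+ (size q).+2 * (1 - p ^+ 2) ^+ size s)%:E.
  apply: IH; first by rewrite -(perm_uniq perm1).
  by move=> t tq; apply: pL; rewrite (perm_mem perm1).
have -> : ones_without_pairs q ((a, b) :: s) =
    ones_without_pairs q s `\` ones_without_pairs [:: a, b & q] s.
  apply/seteqP; split => w.
    move=> [h1 h2]; split.
      by split=> // z zs; apply: h2; rewrite inE zs orbT.
    move=> [h3 _]; apply: (h2 (a, b)); first by rewrite inE eqxx.
    by split; apply: h3; rewrite !inE eqxx ?orbT.
  move=> [[h1 h2] h3]; split=> // z; rewrite inE => /orP[/eqP->|]; last exact: h2.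
  move=> /= [ha hb]; apply: h3; split=> // t.
  by rewrite !inE => /or3P[/eqP->|/eqP->|]//; exact: h1.
rewrite measureD; [|exact: measurable_ones_without_pairs..|]; last first.
  by rewrite ltey_eq fin_num_measure //; exact: measurable_ones_without_pairs.
have -> : ones_without_pairs q s `&` ones_without_pairs [:: a, b & q] s =
    ones_without_pairs [:: a, b & q] s.
  apply/setIidPr => w [h1 h2]; split=> // t tq; apply: h1.
  by rewrite !inE tq !orbT.
by rewrite [X in (X - _)%E]IH1 [X in (_ - X)%E]IH2 -EFinB; congr _%:E; rewrite !exprS; ring.
Qed.

End independent_family.

Lemma measure_union_le (R : realType) (dO : measure_display) (O : measurableType dO)
    (P : probability O R) (J : finType) (Q : pred J) (A : J -> set O) (B : set O) :
  (forall j, measurable (A j)) -> measurable B ->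
  B `<=` [set w | exists2 j, Q j & A j w] ->
  (P B <= \sum_(j | Q j) P (A j))%E.
Proof.
move=> mA mB BA.
pose U := \big[setU/set0]_(j | Q j) A j.
have mU : measurable U by apply: bigsetU_measurable.
apply: (@le_trans _ _ (P U)).
  apply: le_measure; rewrite ?inE // => w /BA[j Qj Ajw].
  by rewrite /U (bigD1 j) //; left.
rewrite /U; suff [] : measurable (\big[setU/set0]_(j | Q j) A j) /\
  (P (\big[setU/set0]_(j | Q j) A j) <= \sum_(j | Q j) P (A j))%E by [].
apply: (big_ind2 (fun S x => measurable S /\ (P S <= x)%E)) => [|S1 x1 S2 x2|j _].
- by rewrite measure0.
- move=> [m1 h1] [m2 h2]; split; first exact: measurableU.
  by apply: le_trans (measureU2 _ m1 m2) _; exact: leeD.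
- by split.
Qed.

(** * Networks whose inner ReLUs are inactive *)

Lemma relu_ge0 (R : realType) n (v : 'cV[R]_n) : (forall i, 0 <= v i 0) -> relu v = v.
Proof.
move=> v0; apply/matrixP => i j; rewrite mxE (ord1 j).
by apply/max_idPl; exact: v0.
Qed.

Definition bounded_by (R : realType) n (B : R) (v : 'cV[R]_n) :=
  forall i, `|v i 0| <= B.

Lemma bounded_relu (R : realType) n (B : R) (v : 'cV[R]_n) :
  bounded_by B v -> bounded_by B (relu v).
Proof.
move=> h i; rewrite mxE; apply: le_trans (h i).
rewrite maxEle; case: ifP => // _; by rewrite normr0.
Qed.

Lemma bounded_sqnorm (R : realType) n (v : 'cV[R]_n) : sqnorm v <= 1 -> bounded_by 1 v.
Proof.
move=> h i; rewrite -(@ler_pXn2r _ 2) ?nnegrE // expr1n; apply: le_trans h.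
rewrite real_normK ?num_real // /sqnorm (bigD1 i) //= lerDl.
by apply: sumr_ge0 => k _; exact: sqr_ge0.
Qed.

(** The sum runs over all rows, not just one: a crude bound for the operator norm with respect to
    the maximum norm. *)
Definition row_l1 (R : realType) m n (A : 'M[R]_(m, n)) : R :=
  \sum_i \sum_j `|A i j|.

Lemma mulmx_bound (R : realType) m n (A : 'M[R]_(m, n)) (B : R) (v : 'cV[R]_n) :
  bounded_by B v -> bounded_by (row_l1 A * B) (A *m v).
Proof.
move=> h i; rewrite mxE; apply: (le_trans (ler_norm_sum _ _ _)).
have B0 (j : 'I_n) : 0 <= B by apply: (le_trans _ (h j)).
rewrite mulr_suml (bigD1 i) //=; rewrite -[leLHS]addr0; apply: lerD.
  rewrite mulr_suml; apply: ler_sum => j _; rewrite normrM.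
  exact: ler_wpM2l.
apply: sumr_ge0 => k _; rewrite mulr_suml; apply: sumr_ge0 => j _.
by rewrite mulr_ge0 // (B0 j).
Qed.

Section recon.
Context (R : realType) (d : nat).

(** Affine maps keep bounded sets bounded and [relu] does not increase absolute values. The bound is
    what makes a sufficiently large inner bias available at every depth. *)
Lemma bounded_target (l : nat) (Ws : nat -> 'M[R]_d) (gs : nat -> 'rV[R]_d)
    (bs : nat -> 'cV[R]_d) :
  exists B : R, forall x, sqnorm x <= 1 -> bounded_by B (target_net l Ws gs bs x).
Proof.
rewrite /target_net; elim: l => [|l [B hB]]; first by exists 1 => x /bounded_sqnorm.
have [B1 hB1] : exists B1 : R, forall x, sqnorm x <= 1 -> bounded_by B1
    (match l with 0 => x | _ => relu (target_net l Ws gs bs x) end).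
  case: l hB => [|l] hB; first by exists 1 => x /bounded_sqnorm.
  by exists B => x hx; apply: bounded_relu; exact: hB.
exists (row_l1 (diag_mx (gs l) *m Ws l) * B1 + \sum_i `|bs l i 0|) => x hx i.
rewrite /= mulmxA mxE; apply: le_trans (ler_normD _ _) _; apply: lerD.
  apply: mulmx_bound; exact: hB1.
by rewrite (bigD1 i) //= lerDl; apply: sumr_ge0.
Qed.

(** The row-wise Khatri-Rao product of the transpose of [We] with [Wo]. Acting on row vectors, it is
    the matrix of the linear map sending [g] to [mxvec (We *m diag_mx g *m Wo)]. *)
Definition khatri_rao n (We : 'M[R]_(d, n)) (Wo : 'M[R]_(n, d)) : 'M[R]_(n, d * d) :=
  \matrix_r mxvec (\matrix_(i, j) (We i r * Wo r j)).

Lemma khatri_raoE n (We : 'M[R]_(d, n)) (Wo : 'M[R]_(n, d)) r i j :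
  khatri_rao We Wo r (mxvec_index i j) = We i r * Wo r j.
Proof. by rewrite mxE mxvecE mxE. Qed.

Lemma khatri_rao_solve (We : 'M[R]_(d, d * d)) (Wo : 'M[R]_(d * d, d)) (W : 'M[R]_d) :
  khatri_rao We Wo \in unitmx ->
  exists g : 'rV[R]_(d * d), We *m diag_mx g *m Wo = W.
Proof.
move=> u; exists (mxvec W *m invmx (khatri_rao We Wo)).
set g := mxvec W *m _.
have gK : g *m khatri_rao We Wo = mxvec W by rewrite /g mulmxKV.
apply/matrixP => i j; rewrite -(mxvecE W) -gK !mxE; apply: eq_bigr => r _.
by rewrite khatri_raoE mul_mx_diag mxE; ring.
Qed.

(* The bias [bo] is so large that the inner ReLU acts as the identity on
   bounded inputs. *)
Lemma recon_block (We : 'M[R]_(d, d * d)) (Wo : 'M[R]_(d * d, d)) (W : 'M[R]_d)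
    (g : 'rV[R]_d) (b : 'cV[R]_d) (B : R) :
  khatri_rao We Wo \in unitmx ->
  exists (go : 'rV[R]_(d * d)) (bo : 'cV[R]_(d * d)) (ge : 'rV[R]_d) (be : 'cV[R]_d),
    forall y, bounded_by B y ->
      diag_mx ge *m (We *m relu (diag_mx go *m (Wo *m y) + bo)) + be =
      diag_mx g *m (W *m y) + b.
Proof.
move=> u; have [go hgo] := khatri_rao_solve W u.
pose bo : 'cV[R]_(d * d) := const_mx (row_l1 (diag_mx go *m Wo) * B).
(* The outer bias cancels the constant that [bo] contributes once the ReLU acts as the identity. *)
exists go, bo, g, (b - diag_mx g *m (We *m bo)) => y hy.
rewrite relu_ge0; last first.
  move=> i; rewrite mxE [bo _ _]mxE mulmxA -lerBlDr sub0r lerNl.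
  by apply: le_trans (ler_norm _) _; rewrite normrN; exact: mulmx_bound.
rewrite !mulmxDr !mulmxA -hgo -!mulmxA addrACA addrC -addrA.
by rewrite [X in _ + X]addrC !mulmxA addrC subrK.
Qed.

Lemma recon_netP (l : nat) (Wo : nat -> 'M[R]_(d * d, d)) (We : nat -> 'M[R]_(d, d * d))
    (Ws : nat -> 'M[R]_d) (gs : nat -> 'rV[R]_d) (bs : nat -> 'cV[R]_d) :
  (forall k, (k < l)%N -> khatri_rao (We k) (Wo k) \in unitmx) ->
  exists (go : nat -> 'rV[R]_(d * d)) (bo : nat -> 'cV[R]_(d * d))
         (ge : nat -> 'rV[R]_d) (be : nat -> 'cV[R]_d),
    forall x : 'cV[R]_d, sqnorm x <= 1 ->
      recon_net l Wo We go bo ge be x = target_net l Ws gs bs x.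
Proof.
move=> u.
(* Each pair of layers is fitted on [y k x], the input that the target network itself feeds to its
   layer [k]; exact agreement at earlier depths makes this the actual input of the pair. *)
pose y k x := match k with 0 => x | _ => relu (target_net k Ws gs bs x) end.
have ybnd k : exists B : R, forall x, sqnorm x <= 1 -> bounded_by B (y k x).
  case: k => [|k]; first by exists 1 => x /bounded_sqnorm.
  have [B hB] := bounded_target k.+1 Ws gs bs.
  by exists B => x hx; apply: bounded_relu; exact: hB.
pose ok k (q : 'rV[R]_(d * d) * 'cV[R]_(d * d) * ('rV[R]_d * 'cV[R]_d)) :=
  (k < l)%N -> forall x, sqnorm x <= 1 ->
  diag_mx q.2.1 *m (We k *m relu (diag_mx q.1.1 *m (Wo k *m y k x) + q.1.2)) + q.2.2 =
  diag_mx (gs k) *m (Ws k *m y k x) + bs k.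
have okE k : exists q, ok k q.
  have [kl|kl] := ltnP k l; last first.
    by exists (0, 0, (0, 0)) => /=; rewrite /ok ltnNge kl.
  have [B hB] := ybnd k.
  have [go [bo [ge [be h]]]] := recon_block (Ws k) (gs k) (bs k) B (u k kl).
  by exists (go, bo, (ge, be)) => _ x /hB; exact: h.
have [q hq] := choice okE.
exists (fun k => (q k).1.1), (fun k => (q k).1.2), (fun k => (q k).2.1),
  (fun k => (q k).2.2) => x hx.
have {u okE} main n : (n <= l)%N -> recon_net n Wo We (fun k => (q k).1.1)
    (fun k => (q k).1.2) (fun k => (q k).2.1) (fun k => (q k).2.2) x =
    target_net n Ws gs bs x.
  rewrite /recon_net /target_net; elim: n => //= n IH nl.
  rewrite -(hq n nl x hx) /y; case: n IH nl => // n IH nl.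
  by rewrite IH // ltnW.
exact: main.
Qed.

End recon.

(** * Singularity of the sparse Khatri-Rao matrix *)

Section sparse_khatri_rao.
Context (R : realType) (d' : nat) (I : finType).
Local Notation d := d'.+1.
Local Notation n := (d * d)%N.
(* Positions, inside the family, of the atomless factors ([ae], [ao]) and of the
   masks ([me], [mo]) of the even ([e]) and odd ([o]) weight matrices *)
Context (ae me : 'I_d -> 'I_n -> I) (ao mo : 'I_n -> 'I_d -> I).
Hypothesis ae_inj : forall i r i' r', ae i r = ae i' r' -> i = i' /\ r = r'.
Hypothesis me_inj : forall i r i' r', me i r = me i' r' -> i = i' /\ r = r'.
Hypothesis ao_inj : forall r j r' j', ao r j = ao r' j' -> r = r' /\ j = j'.
Hypothesis mo_inj : forall r j r' j', mo r j = mo r' j' -> r = r' /\ j = j'.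
Hypothesis aeDao : forall i r r' j, ae i r <> ao r' j.
Hypothesis aeDme : forall i r i' r', ae i r <> me i' r'.
Hypothesis aeDmo : forall i r r' j, ae i r <> mo r' j.
Hypothesis aoDme : forall r j i r', ao r j <> me i r'.
Hypothesis aoDmo : forall r j r' j', ao r j <> mo r' j'.
Hypothesis meDmo : forall i r r' j, me i r <> mo r' j.

Definition sparse_kr (x : I -> R) : 'M[R]_n :=
  khatri_rao (\matrix_(i, r) (x (ae i r) * x (me i r)))
             (\matrix_(r, j) (x (ao r j) * x (mo r j))).

Lemma sparse_krE x r i j : sparse_kr x r (mxvec_index i j) =
  (x (ae i r) * x (me i r)) * (x (ao r j) * x (mo r j)).
Proof. by rewrite khatri_raoE !mxE. Qed.

Lemma measurable_det_sparse_kr :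
  measurable_functional (fun x : I -> R => \det (sparse_kr x)).
Proof.
move=> dT T Z mZ; rewrite /determinant; apply: measurable_sum => s.
apply: measurable_funM; first exact: measurable_cst.
apply: measurable_prod => r _.
case/mxvec_indexP: (s r) => i j.
under eq_fun do rewrite sparse_krE.
by do ?[apply: measurable_funM]; exact: mZ.
Qed.

(** Only row [r0] depends on [v], and it interpolates affinely between its values at 0 and 1, so
    multilinearity of the determinant applies. *)
Lemma det_sparse_kr_affine (v : I) (r0 : 'I_n) :
  (forall x t r c, r != r0 -> sparse_kr (upd x v t) r c = sparse_kr x r c) ->
  (forall x t c, sparse_kr (upd x v t) r0 c =
     (1 - t) * sparse_kr (upd x v 0) r0 c + t * sparse_kr (upd x v 1) r0 c) ->
  affine_in v (fun x => \det (sparse_kr x)).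
Proof.
move=> off on x t.
rewrite (@determinant_multilinear _ _ (sparse_kr (upd x v t))
  (sparse_kr (upd x v 0)) (sparse_kr (upd x v 1)) r0 (1 - t) t); first by ring.
- by apply/rowP => c; rewrite !mxE; have := on x t c; rewrite !mxE.
all: by apply/matrixP => i c; rewrite [LHS]mxE [RHS]mxE !off // eq_sym neq_lift.
Qed.

Lemma updE (x : I -> R) v t u : upd x v t u = if u == v then t else x u.
Proof. by []. Qed.

Lemma affine_ae i0 r0 : affine_in (ae i0 r0) (fun x => \det (sparse_kr x)).
Proof.
have e1 i r : (ae i r == ae i0 r0) = (i == i0) && (r == r0).
  by apply/eqP/andP => [/ae_inj[-> ->]|[/eqP-> /eqP->]].
have e2 i r : (me i r == ae i0 r0) = false by apply/eqP => /esym /aeDme.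
have e3 r j : (ao r j == ae i0 r0) = false by apply/eqP => /esym /aeDao.
have e4 r j : (mo r j == ae i0 r0) = false by apply/eqP => /esym /aeDmo.
apply: (@det_sparse_kr_affine _ r0) => [x t r c /negbTE rr0|x t c];
  case/mxvec_indexP: c => i j; rewrite !sparse_krE !updE e1 e2 e3 e4.
  by rewrite rr0 andbF.
by rewrite eqxx andbT; case: eqP => _; ring.
Qed.

Lemma affine_ao r0 j0 : affine_in (ao r0 j0) (fun x => \det (sparse_kr x)).
Proof.
have e1 r j : (ao r j == ao r0 j0) = (r == r0) && (j == j0).
  by apply/eqP/andP => [/ao_inj[-> ->]|[/eqP-> /eqP->]].
have e2 i r : (me i r == ao r0 j0) = false by apply/eqP => /esym /aoDme.
have e3 i r : (ae i r == ao r0 j0) = false by apply/eqP => /aeDao.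
have e4 r j : (mo r j == ao r0 j0) = false by apply/eqP => /esym /aoDmo.
apply: (@det_sparse_kr_affine _ r0) => [x t r c /negbTE rr0|x t c];
  case/mxvec_indexP: c => i j; rewrite !sparse_krE !updE e1 e2 e3 e4.
  by rewrite rr0.
by rewrite eqxx /=; case: eqP => _; ring.
Qed.

Definition atoms : seq I :=
  enum [pred t | [exists i, exists r, t == ae i r] || [exists r, exists j, t == ao r j]].

Lemma atomsP t : reflect ((exists i r, t = ae i r) \/ (exists r j, t = ao r j))
                         (t \in atoms).
Proof.
rewrite mem_enum inE /=; apply: (iffP orP) => -[].
- by move=> /existsP[i /existsP[r /eqP->]]; left; exists i, r.
- by move=> /existsP[i /existsP[r /eqP->]]; right; exists i, r.
- by move=> [i [r ->]]; left; apply/existsP; exists i; apply/existsP; exists r.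
- by move=> [i [r ->]]; right; apply/existsP; exists i; apply/existsP; exists r.
Qed.

Definition matching_point (f : 'I_n -> 'I_d * 'I_d) (t : I) : R :=
  ([exists r, (t == ae (f r).1 r) || (t == ao r (f r).2)])%:R.

Definition edge (x : I -> R) (r : 'I_n) (z : 'I_d * 'I_d) :=
  (x (me z.1 r) == 1) && (x (mo r z.2) == 1).

Lemma det_at_matching (f : 'I_n -> 'I_d * 'I_d) (x : I -> R) :
  injective f -> (forall r, edge x r (f r)) ->
  \det (sparse_kr (freeze (matching_point f) atoms x)) != 0.
Proof.
move=> fi fx.
have pi_inj : injective (fun r => mxvec_index (f r).1 (f r).2).
  move=> r r' /(congr1 (fun c => enum_val (cast_ord (esym (mxvec_cast d d)) c))).
  rewrite /mxvec_index !cast_ordK !enum_rankK => -[h1 h2]; apply: fi.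
  by rewrite [LHS]surjective_pairing h1 h2 -surjective_pairing.
have -> : sparse_kr (freeze (matching_point f) atoms x) = perm_mx (perm pi_inj).
  apply/matrixP => r c; case/mxvec_indexP: c => i j.
  rewrite sparse_krE !mxE permE /freeze.
  have -> : ae i r \in atoms by apply/atomsP; left; exists i, r.
  have -> : ao r j \in atoms by apply/atomsP; right; exists r, j.
  have -> : (me i r \in atoms) = false.
    by apply/atomsP => -[[? [? /esym /aeDme]]|[? [? /esym /aoDme]]].
  have -> : (mo r j \in atoms) = false.
    by apply/atomsP => -[[? [? /esym /aeDmo]]|[? [? /esym /aoDmo]]].
  have -> : matching_point f (ae i r) = (i == (f r).1)%:R.
    congr (_ : bool)%:R; apply/existsP/eqP => [[r' /orP[/eqP/ae_inj[-> <-]//|]]|->].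
      by move=> /eqP /aeDao.
    by exists r; rewrite eqxx.
  have -> : matching_point f (ao r j) = (j == (f r).2)%:R.
    congr (_ : bool)%:R; apply/existsP/eqP => [[r' /orP[|/eqP/ao_inj[<- ->]//]]|->].
      by move=> /eqP /esym /aeDao.
    by exists r; rewrite eqxx orbT.
  have -> : (mxvec_index (f r).1 (f r).2 == mxvec_index i j) =
            (i == (f r).1) && (j == (f r).2).
    rewrite /mxvec_index (inj_eq (@cast_ord_inj _ _ _)) (inj_eq enum_rank_inj).
    by rewrite xpair_eqE eq_sym; congr andb; rewrite eq_sym.
  (* Only the masks on the matching have to be 1: elsewhere an entry has a zero frozen weight as a
     factor, whatever its masks are. *)
  have /andP[/eqP m1 /eqP m2] := fx r.
  case: eqP => [->|_]; last by rewrite !mul0r.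
  case: eqP => [->|_]; last by rewrite !mul0r mulr0.
  by rewrite m1 m2 !mul1r.
by rewrite det_perm signr_eq0.
Qed.

Definition hall_pair (z : {set 'I_d * 'I_d} * {set 'I_n}) :=
  (#|z.1| + #|z.2| == n.+1)%N.

(** If Hall's condition fails at a set [R0] of rows, at least [n.+1 - #|R0|] positions are joined to
    no row of [R0]; a subset of exactly that size gives the equality in [hall_pair]. *)
Lemma matching_or_hall (x : I -> R) :
  (exists2 f : {ffun 'I_n -> 'I_d * 'I_d}, injective f & forall r, edge x r (f r)) \/
  (exists2 z, hall_pair z & forall ij r, ij \in z.1 -> r \in z.2 -> ~~ edge x r ij).
Proof.
pose N : {ffun 'I_n -> {set 'I_d * 'I_d}} :=
  [ffun r => finset (fun z => edge x r z)].
have [hN|] := pselect (hall N).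
  left; have [f fi fN] := hall_marriage hN.
  exists [ffun r => f r]; first by move=> r r'; rewrite !ffunE; exact: fi.
  by move=> r; have := fN r; rewrite !ffunE inE.
move=> /existsNP[R0 /negP]; rewrite -ltnNge => hR; right.
have [|S SC cS] := @subset_of_card _ (finset.setC (neighbours N R0)) (n.+1 - #|R0|)%N.
  have := cardsC (neighbours N R0); rewrite card_prod !card_ord; lia.
exists (S, R0).
  rewrite /hall_pair /= cS subnK // ltnW // ltnS.
  by rewrite -[X in (_ <= X)%N](card_ord (d * d)) max_card.
move=> ij r /= ijS rR; apply/negP => er.
have := fintype.subsetP SC _ ijS; rewrite inE => /negP; apply.
by apply/bigcupP; exists r => //; rewrite ffunE inE.
Qed.

Context (dO : measure_display) (O : measurableType dO)
  (P : probability O R) (X : I -> O -> R) (p : R) (K : nat).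
Hypothesis indX : mutually_independent P X.
Hypothesis P_me : forall i r, P (X (me i r) @^-1` [set 1]) = p%:E.
Hypothesis P_mo : forall r j, P (X (mo r j) @^-1` [set 1]) = p%:E.
Hypothesis P_ae : forall i r c, P (X (ae i r) @^-1` [set c]) = 0%E.
Hypothesis P_ao : forall r j c, P (X (ao r j) @^-1` [set c]) = 0%E.
Hypothesis p0 : 0 <= p.
Hypothesis p1 : p <= 1.
Hypothesis hp : 2 * (K + 7)%:R * (ln d%:R / d%:R) <= p ^+ 2.

Definition mask_pairs (z : {set 'I_d * 'I_d} * {set 'I_n}) : seq (I * I) :=
  [seq (me ij.1 r, mo r ij.2) | ij <- enum z.1, r <- enum z.2].

(** Over all of [z.1] one mask [me i r] can occur in several pairs, which are then dependent.
    Restricted to one broken diagonal, [i] and [j] determine each other, each mask occurs at most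
    once, and the product formula applies; having fewer pairs to avoid only enlarges the event. *)
Lemma prob_nonedges (z : {set 'I_d * 'I_d} * {set 'I_n}) : hall_pair z ->
  (P (ones_without_pairs X [::] (mask_pairs z)) <=
     ((d%:R^-1 ^+ (K + 7)) ^+ minn #|z.1| #|z.2|)%:E)%E.
Proof.
case: z => S T; rewrite /hall_pair /= => /eqP hST.
have [h hS] := heavy_diagonal S.
set A := finset _ in hS.
pose s := [seq (me i r, mo r (i + h)) | i <- enum A, r <- enum T].
have us1 : uniq (unzip1 s).
  rewrite /unzip1 map_allpairs allpairs_uniq ?enum_uniq //= => -[i r] [i' r'] _ _ /=.
  by move=> /me_inj[-> ->].
have us2 : uniq (unzip2 s).
  rewrite /unzip2 map_allpairs allpairs_uniq ?enum_uniq //= => -[i r] [i' r'] _ _ /=.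
  by move=> /mo_inj[-> /addIr ->].
have ps : P (ones_without_pairs X [::] s) = ((1 - p ^+ 2) ^+ (#|A| * #|T|))%:E.
  rewrite (prob_ones_without_pairs indX (p := p)) /=.
  - by rewrite expr0 mul1r size_allpairs -!cardE.
  - rewrite cat_uniq us1 us2 andbT /=; apply/hasPn => t.
    move=> /mapP[_ /allpairsP[[i r] [_ _ ->]] ->] /=; apply/negP.
    by move=> /mapP[_ /allpairsP[[i' r'] [_ _ ->]] /= /esym /meDmo].
  - move=> t; rewrite mem_cat => /orP[] /mapP[_ /allpairsP[[i r] [_ _ ->]] ->] /=;
    [exact: P_me|exact: P_mo].
apply: (@le_trans _ _ (P (ones_without_pairs X [::] s))).
  apply: le_measure; rewrite ?inE; [exact: (measurable_ones_without_pairs indX)..|].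
  move=> w [_ hw]; split=> // z /allpairsP[[i r] /= [iA rT ->]]; apply: hw.
  apply/allpairsP; exists ((i, i + h), r) => /=; split=> //.
  by move: iA; rewrite !mem_enum inE.
by rewrite ps lee_fin; exact: nonedge_weight.
Qed.

Theorem prob_sparse_kr_singular :
  measurable [set w | \det (sparse_kr (fun t => X t w)) = 0] /\
  (P [set w | \det (sparse_kr (fun t => X t w)) = 0%R] <= (d%:R^-1 ^+ K.+1)%:E)%E.
Proof.
pose F x := \det (sparse_kr x).
have mF : measurable_functional F := measurable_det_sparse_kr.
have mv x0 s := measurable_vanishing indX x0 s mF.
have mS : measurable [set w | F (fun t => X t w) = 0] by exact: (mv (fun=> 0) [::]).
split=> //.
(* The two causes of a zero determinant: an edge-free Hall pair, or a matching [f] whose permutation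
   point gives a nonzero determinant while the sampled weights give zero. Events of the second kind
   are null, so the number of functions [f] costs nothing. *)
pose Q (j : ({set 'I_d * 'I_d} * {set 'I_n}) + {ffun 'I_n -> 'I_d * 'I_d}) :=
  match j with inl z => hall_pair z | inr f => injectiveb f end.
pose A (j : ({set 'I_d * 'I_d} * {set 'I_n}) + {ffun 'I_n -> 'I_d * 'I_d}) : set O :=
  match j with
  | inl z => ones_without_pairs X [::] (mask_pairs z)
  | inr f => [set w | F (fun t => X t w) = 0 /\
                      F (freeze (matching_point f) atoms (fun t => X t w)) <> 0]
  end.
have mA j : measurable (A j).
  case: j => [z|f] /=; first exact: (measurable_ones_without_pairs indX).
  by apply: (measurableI _ _ mS); apply: measurableC; exact: mv.
apply: le_trans (@measure_union_le _ _ _ P _ Q A _ mA mS _) _.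
  move=> w /= Fw; have [[f fi fe]|[z hz ze]] := matching_or_hall (fun t => X t w).
    exists (inr f); first exact/injectiveP.
    by split=> //; apply/eqP; exact: det_at_matching.
  exists (inl z) => //; split=> // _ /allpairsP[[ij r] /= [iz rz ->]] /= [e1 e2].
  rewrite !mem_enum in iz rz; have := ze _ _ iz rz.
  by rewrite /edge e1 e2 !eqxx.
rewrite big_sumType /= [X in (_ + X)%E]big1 ?adde0; last first.
  move=> f _; apply: (unfreeze_null indX) => //.
  - exact: enum_uniq.
  - by move=> t /atomsP[[i [r ->]]|[r [j ->]]]; [exact: affine_ae|exact: affine_ao].
  - by move=> t c /atomsP[[i [r ->]]|[r [j ->]]].
apply: (@le_trans _ _ (\sum_(z | hall_pair z)
    ((d%:R^-1 ^+ (K + 7)) ^+ minn #|z.1| #|z.2|)%:E)%E).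
  by apply: lee_sum => z; exact: prob_nonedges.
rewrite sumEFin lee_fin; apply: hall_weight_sum => //; last exact: card_ord.
by rewrite card_prod !card_ord.
Qed.

End sparse_khatri_rao.

(** * Union bound over the pairs of layers *)

Unset Implicit Arguments.

Theorem theorem3p3 (R : realType) (D : probability R R)
  (hD : continuous_bounded_distr D) (a : R) (ha : 0 < a) :
  exists C : R, 0 < C /\
  exists d0 : nat, forall d : nat, (d0 <= d)%N ->
  forall (l : nat) (p : R),
    l%:R <= d%:R `^ a ->
    C * Num.sqrt (ln d%:R / d%:R) <= p -> p <= 1 ->
  forall (dO : measure_display) (O : measurableType dO) (P : probability O R)
    (* entries of the random factors: odd paper layers 2k+1 (d^2 x d) and
       even paper layers 2k+2 (d x d^2), k = 0, ..., l-1 *)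
    (Wto : 'I_l -> 'I_(d * d) -> 'I_d -> O -> R)
    (Mo  : 'I_l -> 'I_(d * d) -> 'I_d -> O -> R)
    (Wte : 'I_l -> 'I_d -> 'I_(d * d) -> O -> R)
    (Me  : 'I_l -> 'I_d -> 'I_(d * d) -> O -> R),
    (forall k r c (A : set R), measurable A -> P (Wto k r c @^-1` A) = D A) ->
    (forall k r c (A : set R), measurable A -> P (Wte k r c @^-1` A) = D A) ->
    (forall k r c, P (Mo k r c @^-1` [set 1]) = p%:E) ->
    (forall k r c, P (Mo k r c @^-1` [set 0]) = (1 - p)%:E) ->
    (forall k r c, P (Me k r c @^-1` [set 1]) = p%:E) ->
    (forall k r c, P (Me k r c @^-1` [set 0]) = (1 - p)%:E) ->
    mutually_independent P
      (fun t : (('I_l * 'I_(d * d) * 'I_d) + ('I_l * 'I_(d * d) * 'I_d)) +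
               (('I_l * 'I_d * 'I_(d * d)) + ('I_l * 'I_d * 'I_(d * d))) =>
         match t with
         | inl (inl (k, r, c)) => Wto k r c
         | inl (inr (k, r, c)) => Mo k r c
         | inr (inl (k, r, c)) => Wte k r c
         | inr (inr (k, r, c)) => Me k r c
         end) ->
  forall (Ws : nat -> 'M[R]_d) (gs : nat -> 'rV[R]_d) (bs : nat -> 'cV[R]_d),
    (forall k, (k < l)%N -> opnorm_le1 (Ws k)) ->
  exists E : set O, measurable E /\ ((1 - (d%:R)^-1)%:E <= P E)%E /\
  forall w, E w ->
    (* realizations of the frozen sparse weights W_i = Wt_i o M_i *)
    let Wo := fun k : nat => \matrix_(r < d * d, c < d)
        (if (insub k : option 'I_l) is Some i
         then Wto i r c w * Mo i r c w else 0) in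
    let We := fun k : nat => \matrix_(r < d, c < d * d)
        (if (insub k : option 'I_l) is Some i
         then Wte i r c w * Me i r c w else 0) in
    exists (go : nat -> 'rV[R]_(d * d)) (bo : nat -> 'cV[R]_(d * d))
           (ge : nat -> 'rV[R]_d) (be : nat -> 'cV[R]_d),
    forall x : 'cV[R]_d, sqnorm x <= 1 ->
      recon_net l Wo We go bo ge be x = target_net l Ws gs bs x.
Proof.
(* An integer above [a], so that [l <= d^a <= d^K]. *)
pose K := Num.bound a.
have aK : a <= K%:R by rewrite ltW // archi_boundP // ltW.
(* Squaring the lower bound on [p] gives exactly [p^2 >= 2 (K + 7) ln d / d]. *)
exists (Num.sqrt (2 * (K + 7)%:R)); split.
  by rewrite sqrtr_gt0 mulr_gt0 // ltr0n addnS.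
(* The threshold only excludes [d = 0]; the broken diagonals need the additive group on
   ['I_d'.+1]. *)
exists 1%N => -[//|d'] _; set d := d'.+1 => l p hl hC p1 dO O P Wto Mo Wte Me.
move=> lawo lawe mo1 _ me1 _; set X := (X in mutually_independent P X) => indX.
move=> Ws gs bs _.
have dR : 0 < d%:R :> R by rewrite ltr0n.
have L0 : 0 <= ln d%:R / d%:R :> R by rewrite divr_ge0 ?ln_ge0 ?ler1n // ltW.
have p0 : 0 <= p by apply: le_trans hC; rewrite mulr_ge0 ?sqrtr_ge0.
have hp : 2 * (K + 7)%:R * (ln d%:R / d%:R) <= p ^+ 2.
  rewrite -[X in X * _]sqr_sqrtr ?mulr_ge0 // -[X in _ * X <= _]sqr_sqrtr //.
  by rewrite -exprMn lerXn2r // nnegrE mulr_ge0 ?sqrtr_ge0.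
pose kr (k : 'I_l) (w : O) : 'M[R]_(d * d) := sparse_kr
  (fun i r => inr (inl (k, i, r))) (fun i r => inr (inr (k, i, r)))
  (fun r j => inl (inl (k, r, j))) (fun r j => inl (inr (k, r, j))) (fun t => X t w).
have bad k : measurable [set w | \det (kr k w) = 0] /\
    (P [set w | \det (kr k w) = 0%R] <= (d%:R^-1 ^+ K.+1)%:E)%E.
  rewrite /kr; apply: (prob_sparse_kr_singular _ _ _ _ _ _ _ _ _ _ indX _ _ _ _ p0 p1 hp) => //=;
    try by move=> ? ? ? ? [].
  - by move=> i r c; rewrite lawe //; exact: hD.1.
  - by move=> r j c; rewrite lawo //; exact: hD.1.
have mU : measurable (\bigcup_(k : 'I_l) [set w | \det (kr k w) = 0]).
  by apply: fin_bigcup_measurable => [|k _]; [exact: finite_finset|exact: (bad k).1].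
(* The good event: all [l] Khatri-Rao matrices are invertible. It does not depend on the target
   network. *)
exists (~` (\bigcup_(k : 'I_l) [set w | \det (kr k w) = 0])); split.
  exact: measurableC.
split.
  rewrite probability_setC // EFinB leeB //.
  apply: le_trans (@measure_union_le _ _ _ P _ xpredT
    (fun k : 'I_l => [set w | \det (kr k w) = 0%R]) _ (fun k => (bad k).1) mU _) _.
    by move=> w [k _ hk]; exists k.
  apply: (@le_trans _ _ (\sum_(k < l) (d%:R^-1 ^+ K.+1)%:E)%E).
    by apply: lee_sum => k _; exact: (bad k).2.
  rewrite sumEFin lee_fin sumr_const card_ord -[leLHS]mulr_natl.
  have lK : l%:R <= d%:R ^+ K :> R.
    have d1 : 1 <= d%:R :> R by rewrite ler1n.
    by apply: le_trans hl _; have := ler_powR d1 aK; rewrite powR_mulrn // ltW.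
  apply: le_trans (_ : d%:R ^+ K * d%:R^-1 ^+ K.+1 <= _).
    by rewrite ler_wpM2r // exprn_ge0 // invr_ge0 ltW.
  by rewrite exprS mulrCA -exprMn mulfV ?expr1n ?mulr1 // lt0r_neq0.
move=> w Ew Wo We; apply: recon_netP => k kl.
rewrite unitmxE unitfE; apply/eqP => h0; apply: Ew; exists (Ordinal kl) => //=.
(* For [k < l] the partial index [insub k] is [Ordinal kl], so the default weight 0 is never met. *)
rewrite -h0 /kr /sparse_kr; congr (\det (khatri_rao _ _));
  by apply/matrixP => i j; rewrite !mxE insubT.
Qed.
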